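(* Let $n\ge 2$ be even and let $V_1$ and $V_2$ be two closed $n$-dimensional simplicial pseudomanifolds, with every facet having weight $1$. Then there is a connected sum $V_1\#V_2$ (i.e. a choice of bricks and gluing map) such that $$\max(\Omega(V_1),\Omega(V_2))\le\Omega(V_1\#V_2)\le\Omega(V_1)\cup\Omega(V_2).$$
   Context: An $n$-dimensional (closed, simplicial) pseudomanifold is a finite $n$-dimensional simplicial complex such that: it is the union of its $n$-simplices; each $(n-1)$-dimensional face is incident to exactly two $n$-simplices; and the graph with a vertex for each $n$-simplex and an edge joining two vertices exactly when the corresponding simplices share an $(n-1)$-face is connected. The $n$-simplices are called bricks and the $(n-1)$-faces are called facets; each facet is given weight $1$. Connected sum: given distinct $n$-dimensional pseudomanifolds $M_1,M_2$, choose an $n$-simplex $C_i\subset M_i$ for $i=1,2$; $M_1\#M_2$ is the result of removing (the interior of) $C_i$ from $M_i$ and gluing the resulting complexes via some simplicial homeomorphism $\partial C_1\to\partial C_2$. The result depends on the choices of $C_1$, $C_2$ and the gluing map. Width: let $M$ have $N$ bricks, $[N]=\{1,\dots,N\}$, $[N]^*=[N]\cup\{0\}$. An ordering $\mathcal{O}$ is a bijection from the set of bricks to $[N]$. For $j\in[N]^*$, $\Lambda(j)$ is the number of facets shared by a brick $T$ with $\mathcal{O}(T)\le j$ and a brick $T'$ with $\mathcal{O}(T')>j$. A number $t\in[N-1]$ is a (local) maximum for $\mathcal{O}$ if there exist $t_-,t_+\in[N]^*$ with $t_-<t<t_+$, $\Lambda(t_-)<\Lambda(t_-+1)$, $\Lambda(t_+)<\Lambda(t_+-1)$,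 and $\Lambda(t)=\Lambda(k)$ for all $k\in\{t_-+1,\dots,t_+-1\}$. The width $\Omega(\mathcal{O})$ is the sequence of the values of $\Lambda$ at the maxima of $\mathcal{O}$, arranged in non-increasing order (with repetitions). Widths are compared lexicographically (a proper initial segment being smaller). $\Omega(M)$ is the minimal width among all orderings of the bricks of $M$. For two widths, $\Omega(V_1)\cup\Omega(V_2)$ is the sequence with the same terms as the sequences $\Omega(V_1)$ and $\Omega(V_2)$ together (with repetitions), arranged in non-increasing order. *)

(* Defs.v *)
From mathcomp Require Import all_boot all_order.

Set Implicit Arguments.
Unset Strict Implicit.
Unset Printing Implicit Defensive.

Import Order.TTheory.

Section Complex.
Variables (T : finType) (n : nat).
Implicit Type K : {set {set T}}.

(* Abstract simplicial complexes contain the empty face; the vertices are the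
   x with [set x] \in K, so elements of T may be unused.  A simplex of
   dimension d is a face of cardinality d + 1. *)
Definition simplicial_complex K : Prop :=
  set0 \in K /\ forall s t : {set T}, s \in K -> t \subset s -> t \in K.

Definition bricks K : {set {set T}} := [set s in K | #|s| == n.+1].

(* Dimension n - 1; only meaningful for n >= 1. *)
Definition facets K : {set {set T}} := [set s in K | #|s| == n].

Definition adjacent K : rel {set T} := fun B B' =>
  [&& B \in bricks K, B' \in bricks K, B != B' &
      [exists F in facets K, (F \subset B) && (F \subset B')]].

(* The second clause also forces K to contain a brick, as set0 \in K. *)
Definition pseudomanifold K : Prop :=
  [/\ simplicial_complex K,
      forall s, s \in K -> exists2 B, B \in bricks K & s \subset B,
      forall F, F \in facets K -> #|[set B in bricks K | F \subset B]| = 2 &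
      forall B B', B \in bricks K -> B' \in bricks K ->
        connect (adjacent K) B B'].

Definition boundary (C : {set T}) : {set {set T}} :=
  [set s : {set T} | s \proper C].

End Complex.

Section ConnectedSum.
Variables T1 T2 : finType.

(* A simplicial homeomorphism is given by its vertex map; the values of g off
   the vertices of K1 are irrelevant. *)
Definition simplicial_iso (K1 : {set {set T1}}) (K2 : {set {set T2}})
    (g : T1 -> T2) : Prop :=
  {in cover K1 &, injective g} /\ [set g @: s | s : {set T1} in K1] = K2.

Definition glue (C1 : {set T1}) (g : T1 -> T2) (x : T1) : T1 + T2 :=
  if x \in C1 then inr (g x) else inl x.

(* Only the top simplices C1 and C2 are removed, not their proper faces. *)
Definition connected_sum (V1 : {set {set T1}}) (V2 : {set {set T2}})
    (C1 : {set T1}) (C2 : {set T2}) (g : T1 -> T2) : {set {set (T1 + T2)}} :=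
  [set glue C1 g @: s | s : {set T1} in V1 :\ C1] :|:
  [set inr @: s | s : {set T2} in V2 :\ C2].

End ConnectedSum.

Section Width.
Variables (T : finType) (n : nat) (K : {set {set T}}).

Definition brick := {B : {set T} | B \in bricks n K}.

Definition nbricks : nat := #|{: brick}|.

(* Among these finite functions the orderings are the injective ones: they are
   bijective since both sides have the same cardinality.  Positions are shifted
   by one so that they range over {1, ..., nbricks}. *)
Definition preordering := {ffun brick -> 'I_nbricks}.

Definition is_ordering (O : preordering) : bool := injectiveb O.

Definition position (O : preordering) (B : brick) : nat := (O B).+1.

Definition Lambda (O : preordering) (j : nat) : nat :=
  #|[set F in facets n K |
     [exists B : brick, exists B' : brick,
        [&& position O B <= j, j < position O B',
            F \subset val B & F \subset val B']]]|.

Definition is_maximum (O : preordering) (t : nat) : bool :=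
  [exists tm : 'I_nbricks.+1, exists tp : 'I_nbricks.+1,
     [&& tm < t, t < tp,
         Lambda O tm < Lambda O tm.+1, Lambda O tp < Lambda O tp.-1 &
         [forall k : 'I_nbricks.+1,
            (tm < k < tp) ==> (Lambda O t == Lambda O k)]]].

(* seqlexi nat is seq nat with the lexicographic order, in which a proper
   prefix is smaller. *)
Definition width_of (O : preordering) : seqlexi nat :=
  sort geq [seq Lambda O t | t <- iota 1 nbricks.-1 & is_maximum O t].

Definition enum_ordering : preordering := [ffun B => enum_rank B].

Definition width : seqlexi nat :=
  width_of [arg min_(O < enum_ordering | is_ordering O) width_of O]%O.

Lemma enum_orderingP : is_ordering enum_ordering.
Proof. by apply/injectiveP=> B B'; rewrite !ffunE; apply: enum_rank_inj. Qed.

Lemma width_attained : exists2 O, is_ordering O & width = width_of O.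
Proof.
by rewrite /width; case: arg_minP => [|O ? _]; [exact: enum_orderingP|exists O].
Qed.

Lemma width_min O : is_ordering O -> (width <= width_of O)%O.
Proof.
by rewrite /width; case: arg_minP => [|O' _]; [exact: enum_orderingP|exact].
Qed.

End Width.

Definition width_union (w1 w2 : seqlexi nat) : seqlexi nat :=
  sort geq ((w1 : seq nat) ++ (w2 : seq nat)).

(* Main.v *)
Require Import Defs.
From mathcomp Require Import all_boot all_order.
From mathcomp Require Import zify.

Set Implicit Arguments.
Unset Strict Implicit.
Unset Printing Implicit Defensive.

Import Order.TTheory.

(** Call dual graph the graph on the bricks with one edge per facet.  It is
    [n + 1]-regular and [n + 1] is odd, so [Lambda] changes parity at every step:
    it has no plateau, and the width lists its strict peaks.  Two non-increasing
    sequences shorter than [k] compare lexicographically as the numbers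
    [\sum k ^ x] do ([lexi_of_weight]), so all comparisons of widths reduce to
    inequalities between sums of [k ^ x] over peaks.

    Upper bound.  Take for [C1] the last brick of an optimal ordering of [V1] and
    for [C2] the first brick of an optimal ordering of [V2], and concatenate the
    two orderings without [C1] and [C2].  The resulting profile is that of [V1]
    followed by that of [V2], joined at the value [n + 1].  Both profiles are
    larger than [n + 1] next to the junction, which is therefore not a peak, and
    the peaks are exactly those of the two profiles ([concat_orderings]).

    Lower bound, for every choice of bricks and gluing map.  The facets separating
    a set of bricks from its complement form an [(n - 1)]-cycle modulo 2, and a
    nonzero such cycle has at least [n + 1] simplices ([cut_ge]); so, by strong
    connectivity, the dual graph is [(n + 1)]-edge-connected.  Given an ordering
    of the sum with profile [b], keep the order of the bricks of [V1] and insert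
    the missing brick [C] at some time [m].  Before [m] the profile of the new
    ordering is the cut [lo] of the bricks of [V1] met so far, after [m] it is the
    cut [hi] obtained by adding all bricks of [V2].  Edge-connectivity and
    submodularity of cuts give [lo <= b] until all bricks of [V2] have been met and
    [hi <= b] once one of them has been met; submodularity also shows that, at a
    brick of [V1], the change of [b] lies between those of [hi] and [lo].
    Pointwise domination alone would not control the number of peaks, but with
    this control on the slopes each peak of [b] weighs at least as much as all the
    peaks of [lo] passed while [b] descends from it ([passed_coupled]); for [hi]
    the same holds with time reversed.  Finally [m] can be chosen so that the peak created
    at the insertion is paid for by a peak of [b] not used otherwise
    ([insertion_time]).  The two summands play symmetric roles once both are
    embedded in a common vertex type ([sum_along]). *)

(** * Peaks of sequences of natural numbers *)

(** If [s1] came after [s2], then at their first difference [s1] would have a term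
    [x] such that [K ^ x] alone exceeds the sum over the rest of [s2], which has
    fewer than [K] terms, each at most [K ^ (x - 1)]. *)
Lemma lexi_of_weight K (s1 s2 : seq nat) :
    1 < K -> size s2 < K -> sorted geq s2 ->
    \sum_(x <- s1) K ^ x <= \sum_(x <- s2) K ^ x ->
  ((s1 : seqlexi nat) <= (s2 : seqlexi nat))%O.
Proof.
move=> K1 sK srt2 wle.
rewrite leNgt; apply/negP => lt21; move: wle; apply/negP; rewrite -ltnNge.
elim: s2 s1 srt2 sK lt21 => [|y s2 IH] [|x s1] srt2 sK //.
  by rewrite big_nil big_cons ltn_addr // expn_gt0 ltnW.
rewrite ltxi_cons !leEnat => /andP[le_yx /implyP lt_s].
rewrite !big_cons; case: (ltnP y x) => [lt_yx|le_xy].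
- have geY : all (geq y) s2 by apply: order_path_min srt2 => a b c /=; lia.
  have sumle : \sum_(z <- s2) K ^ z <= size s2 * K ^ y.
    rewrite -sum1_size big_distrl /= big_seq [leqRHS]big_seq.
    apply: leq_sum => z /(allP geY) /= zy.
    by rewrite mul1n leq_pexp2l // ltnW.
  apply: leq_trans (leq_addr _ _).
  apply: (@leq_trans (K ^ y.+1)); last by rewrite leq_pexp2l // ltnW.
  have K0 : 0 < K ^ y by rewrite expn_gt0 ltnW.
  rewrite expnS; move: sK => /= sK; nia.
- have -> : y = x by lia.
  rewrite ltn_add2l; apply: IH; [exact: path_sorted srt2|exact: ltnW|exact: lt_s].
Qed.

Section Peaks.
Variable K : nat.

(** The direction of the last strict change of [f] before [t].  Constant
    stretches are ignored, so a profile may be read along a time that stands still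
    for some steps. *)
Fixpoint climbing (f : nat -> nat) (t : nat) : bool :=
  if t is t'.+1 then
    if f t' < f t'.+1 then true
    else if f t'.+1 < f t' then false else climbing f t'
  else true.

(** The total weight of the peaks from which [f] has already started to descend at
    time [t]. *)
Fixpoint passed (f : nat -> nat) (t : nat) : nat :=
  if t is t'.+1 then
    passed f t' + (climbing f t' && (f t'.+1 < f t')) * K ^ f t'
  else 0.

Lemma eq_passed (f g : nat -> nat) m :
    (forall t, t <= m -> f t = g t) ->
  passed f m = passed g m /\ climbing f m = climbing g m.
Proof.
elim: m => [|m IH] fg //=.
have [-> ->] := IH (fun t le_tm => fg t (leqW le_tm)).
by rewrite !fg.
Qed.

Lemma passed_homo f m m' : m <= m' -> passed f m <= passed f m'.
Proof.
elim: m' => [|m' IH]; first by rewrite leqn0 => /eqP->.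
rewrite leq_eqVlt => /predU1P[->//|/IH/leq_trans]; apply; exact: leq_addr.
Qed.

Definition unit_steps (phi : nat -> nat) m :=
  phi 0 = 0 /\ forall t, t < m -> phi t.+1 = phi t \/ phi t.+1 = (phi t).+1.

Lemma passed_reparam f phi m : unit_steps phi m ->
  passed (f \o phi) m = passed f (phi m) /\
  climbing (f \o phi) m = climbing f (phi m).
Proof.
case=> phi0; elim: m => [|m IH] step /=; first by rewrite phi0.
have [-> ->] := IH (fun t le_tm => step t (leqW le_tm)).
have [->|->] /= := step m (leqnn _); last by [].
by rewrite ltnn andbF addn0.
Qed.

Definition reversed N (f : nat -> nat) : nat -> nat := fun t => f (N - t).

(** A peak is passed either before [t], or after [t] when time runs backwards,
    except for a peak at [t] itself, which [f] climbs to from both sides.  The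
    extra term on the left is the unfinished climb at the end. *)
Lemma passed_split f N t : t <= N ->
  passed f N + climbing f N * K ^ f N
    = passed f t + passed (reversed N f) (N - t)
      + (climbing f t && climbing (reversed N f) (N - t)) * K ^ f t.
Proof.
move=> le_tN.
rewrite -(subKn le_tN); have : N - t <= N by exact: leq_subr.
elim: (N - t) => [|d IH] ltdN.
  by rewrite subn0 subnn /= andbT addn0.
rewrite IH; last exact: ltnW.
have -> : N - d = (N - d.+1).+1 by lia.
set u := N - d.+1.
have -> : N - u.+1 = d by rewrite /u; lia.
have -> : N - u = d.+1 by rewrite /u; lia.
have r0 : reversed N f d = f u.+1 by congr f; rewrite /u; lia.
have r1 : reversed N f d.+1 = f u by [].
rewrite /= r0 r1; case: (ltngtP (f u) (f u.+1)) => cmp /=; rewrite ?cmp;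
  case: (climbing f u); case: (climbing (reversed N f) d) => /=; lia.
Qed.

(** The two kinds of step of an ordering of the sum: a brick of the first summand
    makes [lo] fall at most as much as [b], and a brick of the second one leaves
    [lo] unchanged. *)
Definition coupled (lo b : nat -> nat) t :=
  lo t + b t.+1 <= lo t.+1 + b t \/ lo t.+1 = lo t.

Lemma expn_gap x y : 1 < K -> x < y -> K ^ x + K ^ x <= K ^ y.
Proof.
move=> K1 ltxy; apply: (@leq_trans (K ^ x.+1)).
  by rewrite expnS addnn -mul2n leq_mul2r K1 orbT.
by rewrite leq_pexp2l // ltnW.
Qed.

(** While [b] climbs, [lo] cannot descend.  Once [b] has passed a peak, either [lo]
    agrees with [b] and descends together with it, passing at most one peak, of
    equal weight, or the peak of [b] outweighs those of [lo] by at least [K ^ b t] at the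
    current time [t].  As [b] decreases strictly, this reserve pays for each further
    peak of [lo] met during the descent, for [K ^ (x - 1) + K ^ (x - 1) <= K ^ x]. *)
Lemma passed_coupled lo b m : 1 < K ->
    (forall t, t <= m -> lo t <= b t) ->
    (forall t, t < m -> b t != b t.+1) ->
    (forall t, t < m -> coupled lo b t) ->
  passed lo m <= passed b m.
Proof.
move=> K1 dom noplat step.
suff [] : passed lo m <= passed b m /\ (~~ climbing b m ->
    (lo m = b m /\ ~~ climbing lo m) \/ passed lo m + K ^ b m <= passed b m).
  by [].
elim: m dom noplat step => [|m IH] dom noplat step //.
have [le_p inv] := IH (fun t le => dom t (leqW le))
  (fun t le => noplat t (leqW le)) (fun t le => step t (leqW le)).
have d0 := dom m (leqW (leqnn m)); have d1 := dom m.+1 (leqnn _).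
have np := noplat m (leqnn _); have st := step m (leqnn _).
rewrite /=; case: (ltngtP (b m) (b m.+1)) np => [up|dn|] // _.
  have -> : lo m.+1 < lo m = false by case: st; lia.
  by rewrite !andbF !addn0.
have gap : K ^ b m.+1 <= K ^ b m by rewrite leq_pexp2l ?(ltnW K1) // ltnW.
rewrite andbT; case: (ltngtP (lo m) (b m)) d0 => // [lt_lb|eq_lb] _; last first.
(* At a common value, domination at the next time forces the two to descend
   together. *)
  have eq1 : lo m.+1 = b m.+1 by case: st; lia.
  rewrite eq1 eq_lb dn andbT ltnNge (ltnW dn) /=.
  case cb: (climbing b m).
    split; last by left.
    by rewrite leq_add // leq_mul2r leq_b1 orbT.
  move: inv; rewrite cb => /(_ isT) [[_ /negPf->]|inv].
    by rewrite !addn0; split=> // _; left.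
  split; last by left.
  rewrite mul0n addn0 (leq_trans _ inv) // leq_add2l.
  by rewrite -[leqRHS]mul1n leq_mul2r leq_b1 orbT.
set A := (climbing lo m && _).
have Ale : A * K ^ lo m + K ^ b m.+1 <= K ^ b m.
  have [lt|ge] := ltnP (lo m) (b m.+1).
    apply: leq_trans (expn_gap K1 dn); rewrite leq_add2r.
    apply: (@leq_trans (K ^ lo m)).
      by rewrite -[leqRHS]mul1n leq_mul2r leq_b1 orbT.
    by rewrite leq_pexp2l ?(ltnW K1) // ltnW.
  apply: leq_trans (expn_gap K1 lt_lb); apply: leq_add.
    by rewrite -[leqRHS]mul1n leq_mul2r leq_b1 orbT.
  by rewrite leq_pexp2l ?(ltnW K1).
suff H : passed lo m + A * K ^ lo m + K ^ b m.+1
    <= passed b m + climbing b m * K ^ b m.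
  by split; [lia|right].
case cb: (climbing b m) => /=.
  lia.
move: inv; rewrite cb => /(_ isT) [[]|]; lia.
Qed.

(** The insertion takes one unit of time: [lo m] at time [m], [hi m] at the next. *)
Definition inserted (lo hi : nat -> nat) m t := if t <= m then lo t else hi t.-1.

Lemma passed_inserted lo hi m N : m <= N ->
  passed (inserted lo hi m) N.+1 <=
    passed lo m + passed (reversed N hi) (N - m) +
    if lo m < hi m then climbing (reversed N hi) (N - m) * K ^ hi m
    else climbing lo m * K ^ lo m.
Proof.
move=> le_mN; apply: leq_trans (leq_addr (climbing (inserted lo hi m) N.+1
  * K ^ inserted lo hi m N.+1) _) _.
rewrite (passed_split _ (leqW le_mN)) subSn //=.
have [|-> ->] := @eq_passed (inserted lo hi m) lo m.
  by move=> t le_tm; rewrite /inserted le_tm.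
have [|-> ->] := @eq_passed (reversed N.+1 (inserted lo hi m))
    (reversed N hi) (N - m).
  move=> t le_t; rewrite /reversed /inserted ifF; last by lia.
  by congr hi; lia.
have -> : inserted lo hi m m = lo m by rewrite /inserted leqnn.
have -> : reversed N.+1 (inserted lo hi m) (N - m) = hi m.
  rewrite /reversed /inserted ifF; last by lia.
  by congr hi; lia.
have -> : reversed N.+1 (inserted lo hi m) (N - m).+1 = lo m.
  by rewrite /reversed /inserted subSS subKn // leqnn.
by case: (ltngtP (lo m) (hi m)) => cmp /=; rewrite ?cmp;
  case: (climbing lo m); case: (climbing (reversed N hi) (N - m)) => /=; lia.
Qed.

(** Times [i] and [l] are those at which the first and the last brick of the second
    summand have just been met.  If [b] has a peak in between, the insertion there
    creates at most one peak, no higher than that peak of [b].  Otherwise [b] descends at step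
    [i] or climbs at step [l]; inserting just before [i], respectively right after
    [l], at a moment where [b] agrees with [lo], respectively [hi], creates no peak
    that [b] lacks. *)
Lemma insertion_time N b lo hi i l : 1 < K -> 0 < i -> i < l -> l <= N ->
    b 0 = 0 -> b N = 0 -> (forall t, t < N -> b t != b t.+1) ->
    (forall t, t < i -> lo t = b t) ->
    (forall t, l <= t -> t <= N -> hi t = b t) ->
    (forall t, t < l -> lo t <= b t) ->
    (forall t, i <= t -> t <= N -> hi t <= b t) ->
    (forall t, t < N ->
      (lo t + b t.+1 <= lo t.+1 + b t /\ b t + hi t.+1 <= hi t + b t.+1) \/
      (lo t.+1 = lo t /\ hi t.+1 = hi t)) ->
    hi i = hi i.-1 -> lo l = lo l.-1 ->
  exists2 m, m <= N & passed (inserted lo hi m) N.+1 <= passed b N.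
Proof.
move=> K1 i0 lt_il le_lN b0 bN noplat lob hib dlo dhi step hi_i lo_l.
have half1 m : m < l -> passed lo m <= passed b m.
  move=> lt_ml; apply: passed_coupled => // t lt_tm.
  - by apply: dlo; lia.
  - by apply: noplat; lia.
  - by case: (step t) => [|[? _]|[? _]]; [lia|left|right].
have half2 m : i <= m -> m <= N ->
    passed (reversed N hi) (N - m) <= passed (reversed N b) (N - m).
  move=> le_im le_mN; apply: passed_coupled => // t lt_tm; rewrite /reversed.
  - by apply: dhi; lia.
  - have -> : N - t = (N - t.+1).+1 by lia.
    by rewrite eq_sym; apply: noplat; lia.
  - rewrite /coupled; have -> : N - t = (N - t.+1).+1 by lia.
    by case: (step (N - t.+1)) => [|[_ ?]|[_ ?]]; [lia|left; lia|right].
have splitb m : m <= N -> passed b N = passed b m + passed (reversed N b) (N - m)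
      + (climbing b m && climbing (reversed N b) (N - m)) * K ^ b m.
  move/passed_split=> <-; suff -> : climbing b N = false by rewrite addn0.
  have : N.-1 < N by lia.
  move=> /[dup] /noplat; case: (N) bN => //= N' -> np _.
  by rewrite lt0n np.
have downb m : m < N -> b m.+1 < b m -> climbing (reversed N b) (N - m).
  move=> lt_mN dn; have -> : N - m = (N - m.+1).+1 by lia.
  rewrite /= /reversed.
  have -> : N - (N - m.+1) = m.+1 by lia.
  have -> : N - (N - m.+1).+1 = m by lia.
  by rewrite dn.
have upb m : b m < b m.+1 -> climbing b m.+1 by move=> /= ->.
have at_peak m : i <= m -> m < l -> lo m <= b m -> hi m <= b m ->
    climbing b m -> b m.+1 < b m ->
    exists2 m, m <= N & passed (inserted lo hi m) N.+1 <= passed b N.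
  move=> le_im lt_ml le_lo le_hi up dn.
  have le_mN : m <= N by lia.
  exists m => //; apply: leq_trans (passed_inserted _ _ le_mN) _.
  rewrite (splitb m) // up downb //; last by lia.
  have := half1 m lt_ml; have := half2 m le_im le_mN.
  have : K ^ lo m <= K ^ b m by rewrite leq_pexp2l ?(ltnW K1).
  have : K ^ hi m <= K ^ b m by rewrite leq_pexp2l ?(ltnW K1).
  case: ifP => _; [case: (climbing (reversed N hi) _)|case: (climbing lo m)];
    rewrite /=; lia.
(* The first descent of b from time i - 1 on *)
have exd : exists t, (i.-1 <= t < N) && (b t.+1 < b t).
  case: (boolP [exists t : 'I_N, (i.-1 <= t) && (b t.+1 < b t)]).
    by case/existsP=> t /andP[? ?]; exists t; apply/andP; split=> //; apply/andP; split.
  rewrite negb_exists => /forallP nodn.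
  have asc t : i.-1 <= t -> t < N -> b t <= b t.+1.
    by move=> le lt; have := nodn (Ordinal lt); rewrite /= le -leqNgt.
  have mono t : i <= t -> t <= N -> b i <= b t.
    elim: t => [|t IH]; first by lia.
    rewrite leq_eqVlt => /predU1P[->//|lt_it] lt_tN.
    by apply: leq_trans (IH _ _) (asc t _ _); lia.
  have := mono N; have := asc i.-1; have := noplat i.-1.
  by rewrite prednK // bN; lia.
case: (ex_minnP exd) => m /andP[/andP[le_im lt_mN] dn] minm.
have asc t : i.-1 <= t -> t < m -> b t < b t.+1.
  move=> le_it lt_tm; have := noplat t; have := minm t.
  rewrite le_it; case: (ltngtP (b t) (b t.+1)) => // ?; lia.
case: (ltnP m i) => [lt_mi|le_im'].
(* The first brick of the second summand lowers b: insert just before it. *)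
  have defi : m.+1 = i by lia.
  exists m; first exact: ltnW.
  apply: leq_trans (passed_inserted _ _ (ltnW lt_mN)) _.
  rewrite (splitb m) ?(ltnW lt_mN) // downb // andbT.
  have [] := @eq_passed lo b m; first by move=> t le_tm; apply: lob; lia.
  move=> -> ->; rewrite (lob m) //.
  have him : hi m <= b i.
    have -> : hi m = hi i by rewrite -defi in hi_i *.
    by apply: dhi; lia.
  rewrite ifF; last by move: him dn; rewrite -defi; lia.
  rewrite leq_add2r leq_add2l.
  have -> : N - m = (N - i).+1 by lia.
  have h2 := half2 i (leqnn i) (leq_trans (ltnW lt_il) le_lN).
  apply: leq_trans (leq_trans h2 (leq_addr _ _)).
  rewrite /= {2 3 4}/reversed; have -> : N - (N - i).+1 = m by lia.
  have -> : N - (N - i) = m.+1 by lia.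
  have -> : hi m = hi m.+1 by rewrite defi hi_i -defi.
  by rewrite ltnn andbF addn0.
have up : climbing b m.
  have -> : m = m.-1.+1 by lia.
  by apply: upb; apply: asc; lia.
case: (ltnP m l) => [lt_ml|le_lm].
  by apply: (at_peak m) => //; [apply: dlo|apply: dhi; lia].
(* b climbs during the whole window: insert right after it. *)
have asc_l := asc l.-1; rewrite prednK in asc_l; last by lia.
have up_l : b l.-1 < b l by apply: asc_l; lia.
exists l => //; apply: leq_trans (passed_inserted _ _ le_lN) _.
have lol : lo l <= b l.-1 by rewrite lo_l; apply: dlo; lia.
have hil : hi l = b l by apply: hib.
rewrite (splitb l) // hil ifT; last by lia.
have [] := @eq_passed (reversed N hi) (reversed N b) (N - l).
  by move=> t le_t; apply: hib; lia.
move=> -> ->; have -> : climbing b l.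
  by move: (upb l.-1); rewrite prednK; [apply|lia].
rewrite leq_add2r leq_add2r.
have -> : passed lo l = passed lo l.-1.
  have -> : l = l.-1.+1 by lia.
  rewrite /= prednK; last by lia.
  by rewrite lo_l ltnn andbF addn0.
apply: leq_trans (half1 l.-1 _) (passed_homo _ _); lia.
Qed.

(** The junction is a valley or lies on a slope, so it neither adds nor removes a
    peak; the last step of [f1] and the first one of [f2] pass none. *)
Lemma passed_concat f f1 f2 p q : 0 < p -> 0 < q ->
    (forall t, t <= p -> f t = f1 t) -> (forall j, f (p + j) = f2 j.+1) ->
    f1 p < f1 p.-1 -> f2 0 = 0 -> f2 1 < f2 2 ->
  passed f (p + q) = passed f1 p.+1 + passed f2 q.+1.
Proof.
move=> p0 q0 ff1 ff2 dn1 f2_0 up2.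
have dn1' : climbing f1 p = false.
  by case: (p) p0 dn1 => // u _ /= dn; rewrite ltnNge (ltnW dn) dn.
have [e1 c1] := eq_passed ff1.
have -> : passed f1 p.+1 = passed f1 p by rewrite /= dn1' addn0.
have fp : f p = f2 1 by rewrite -ff2 addn0.
have fp1 : f p.+1 = f2 2 by rewrite -ff2 addn1.
suff [] : passed f (p + q) = passed f1 p + passed f2 q.+1
    /\ climbing f (p + q) = climbing f2 q.+1 by [].
elim: q q0 => // -[|j] IH _.
  rewrite addn1 /= e1 c1 dn1' fp fp1 f2_0 up2 ltn0 /=.
  by rewrite (ltnNge (f2 2)) (ltnW up2) andbF !addn0.
have [eP eC] := IH isT.
have pj : f (p + j.+1) = f2 j.+2 by exact: ff2.
have pj1 : f (p + j.+1).+1 = f2 j.+3 by rewrite -addnS ff2.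
rewrite addnS.
have unP g u :
    passed g u.+1 = passed g u + (climbing g u && (g u.+1 < g u)) * K ^ g u by [].
have unC g u : climbing g u.+1 = if g u < g u.+1 then true
  else if g u.+1 < g u then false else climbing g u by [].
rewrite (unP f) (unC f) (unP f2 j.+2) (unC f2 j.+2) eP eC pj pj1; split=> //.
by rewrite addnA.
Qed.

Definition peak (f : nat -> nat) t := (f t.-1 < f t) && (f t.+1 < f t).

Lemma passed_peaks f m : f 0 = 0 -> (forall t, t < m -> f t != f t.+1) ->
  passed f m = \sum_(1 <= t < m | peak f t) K ^ f t.
Proof.
move=> f0; elim: m => [|m IH] np; first by rewrite big_geq.
rewrite /= IH; last by move=> t /leqW; apply: np.
case: m np {IH} => [|m] np.
  by rewrite f0 ltn0 andbF !big_geq.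
rewrite [RHS]big_mkcond big_nat_recr //= -big_mkcond /=; congr (_ + _).
rewrite /peak /=; have := np m (leqnSn _).
by case: (ltngtP (f m) (f m.+1)) => //= _ _; case: (_ < _); rewrite ?mul1n.
Qed.

End Peaks.

(** * Cuts of sets of bricks *)

Lemma odd_sum (I : finType) (P : pred I) (f g : I -> nat) :
    (forall i, P i -> odd (f i) = odd (g i)) ->
  odd (\sum_(i | P i) f i) = odd (\sum_(i | P i) g i).
Proof. by move=> fg; rewrite !(big_morph odd oddD (erefl _)); apply: eq_bigr. Qed.

Section Cut.
Variables (T : finType) (n : nat) (K : {set {set T}}).
Implicit Types (F B R : {set T}) (S X Y : {set {set T}}).

Definition hits S F := [exists B in bricks n K :&: S, F \subset B].

Definition crossing S := [set F in facets n K | hits S F && hits (~: S) F].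

Definition cut S := #|crossing S|.

Lemma hitsP S F :
  reflect (exists B, [/\ B \in bricks n K, B \in S & F \subset B]) (hits S F).
Proof.
apply: (iffP existsP) => -[B].
  by rewrite inE => /andP[/andP[? ?] ?]; exists B.
by case=> ? ? ?; exists B; rewrite inE; apply/andP; split=> //; apply/andP.
Qed.

Lemma eq_cut S S' : {in bricks n K, S =i S'} -> cut S = cut S'.
Proof.
move=> eqS; rewrite /cut; congr #|pred_of_set _|; apply/setP=> F; rewrite !inE.
congr (_ && (_ && _)); apply/hitsP/hitsP => -[B [Bb BS sFB]];
  by exists B; split=> //; move: BS; rewrite ?inE eqS.
Qed.

Lemma cutC S : cut (~: S) = cut S.
Proof. by apply: eq_card => F; rewrite !inE setCK [hits (~: S) F && _]andbC. Qed.

Lemma cut0 : cut set0 = 0.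
Proof.
apply/eqP; rewrite cards_eq0; apply/eqP/setP=> F; rewrite !inE.
apply/negP => /and3P[_ /hitsP[B [_]]]; by rewrite inE.
Qed.

Lemma cut_submodular X Y : cut (X :|: Y) + cut (X :&: Y) <= cut X + cut Y.
Proof.
have cutE S : cut S = \sum_(F in facets n K) (hits S F && hits (~: S) F).
  rewrite /cut -sum1_card -big_mkcondr /=; apply: eq_bigl => F.
  by rewrite /crossing [LHS]inE.
rewrite !cutE -!big_split /=; apply: leq_sum => F _.
have hU S S' : hits (S :|: S') F = hits S F || hits S' F.
  apply/hitsP/orP => [[B [Bb]]|].
    by rewrite inE => /orP[BS|BS] sFB; [left|right]; apply/hitsP; exists B.
  by case=> /hitsP[B [Bb BS sFB]]; exists B; rewrite in_setU BS ?orbT; split.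
have hI S S' : hits (S :&: S') F -> hits S F && hits S' F.
  case/hitsP=> B [Bb]; rewrite inE => /andP[? ?] ?.
  by apply/andP; split; apply/hitsP; exists B.
rewrite setCI setCU !hU; move: (hI X Y) (hI (~: X) (~: Y)).
by do 6!case: (hits _ F) => //=; do 2![move/(_ isT)=> // _ | move=> _].
Qed.

(** Submodularity applied to [X] and the complement of [Y]. *)
Lemma cut_posimodular X Y : cut (X :\: Y) + cut (Y :\: X) <= cut X + cut Y.
Proof.
rewrite -(cutC Y) -(cutC (Y :\: X)) addnC setCD setDE setUC.
exact: cut_submodular.
Qed.

(** Chamber systems in which every panel lies in two chambers are called thin. *)
Definition thin : Prop :=
  (forall B F, B \in bricks n K -> F \subset B -> #|F| = n -> F \in facets n K) /\
  (forall F, F \in facets n K -> #|[set B in bricks n K | F \subset B]| = 2).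

Hypothesis thinK : thin.

Lemma card_brick B : B \in bricks n K -> #|B| = n.+1.
Proof. by rewrite inE => /andP[_ /eqP]. Qed.

Lemma card_between B R : R \subset B -> #|B| = n.+1 ->
  #|[set F : {set T} | [&& R \subset F, F \subset B & #|F| == n]]| = n.+1 - #|R|.
Proof.
move=> sRB cB; transitivity #|[set B :\ x | x in B :\: R]|.
  apply: eq_card => F; rewrite inE; apply/and3P/imsetP => [[sRF sFB cF]|].
    have : #|B :\: F| == 1.
      by rewrite cardsD (setIidPr sFB) cB (eqP cF) subSnn.
    case/cards1P=> x dx; exists x.
      have : x \in B :\: F by rewrite dx set11.
      rewrite !inE => /andP[xF ->]; rewrite andbT.
      by apply: contra xF => /(subsetP sRF).
    by rewrite -dx setDDr setDv set0U (setIidPr sFB).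
  case=> x; rewrite inE => /andP[xR xB] ->; split.
  - by rewrite subsetD1 sRB.
  - exact: subD1set.
  - by move: cB; rewrite (cardsD1 x) xB add1n => -[->].
rewrite card_in_imset ?cardsD ?(setIidPr sRB) ?cB // => x y.
rewrite !inE => /andP[_ xB] /andP[_ yB] /setP/(_ x).
by rewrite !inE eqxx xB andbT; case: eqP.
Qed.

(** A facet lies in two bricks, and crosses when exactly one of them is in [S]. *)
Lemma crossing_odd S F : F \in facets n K ->
  (F \in crossing S) = odd #|[set B in bricks n K :&: S | F \subset B]|.
Proof.
move=> fF; rewrite inE fF /=; have := proj2 thinK F fF.
rewrite -(cardsID S).
have <- : [set B in bricks n K :&: S | F \subset B]
    = [set B in bricks n K | F \subset B] :&: S.
  by apply/setP=> B; rewrite !inE andbAC.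
have hE S' : hits S' F = (0 < #|[set B in bricks n K :&: S' | F \subset B]|).
  apply/hitsP/card_gt0P => -[B].
    by case=> bB SB sFB; exists B; rewrite in_set in_setI bB SB sFB.
  by rewrite in_set in_setI => /andP[/andP[? ?] ?]; exists B.
rewrite !hE.
have <- : [set B in bricks n K :&: ~: S | F \subset B]
    = [set B in bricks n K | F \subset B] :\: S.
  by apply/setP=> B; rewrite !inE; case: (B \in S); rewrite /= ?andbT ?andbF.
by case: #|_| => [|[|[|m]]] //=; case: #|_| => [|[|m']].
Qed.

(** Double counting modulo 2 of the pairs of a facet and a brick of [S] around
    [R].  For [R] empty this gives the parity of a cut; for [R] of size [n - 1] it
    says that the crossing facets form a cycle modulo 2. *)
Lemma odd_crossing_over S R :
  odd #|[set F in crossing S | R \subset F]| =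
  odd (#|[set B in bricks n K :&: S | R \subset B]| * (n.+1 - #|R|)).
Proof.
have -> : #|[set F in crossing S | R \subset F]| =
    \sum_(F in facets n K | R \subset F) (F \in crossing S).
  rewrite -sum1_card -big_mkcondr; apply: eq_bigl => F.
  rewrite in_set; case crF: (F \in crossing S); last by rewrite andbF.
  by move: crF; rewrite in_set => /andP[-> _]; rewrite andbT.
transitivity (odd (\sum_(F in facets n K | R \subset F)
    \sum_(B in bricks n K :&: S | F \subset B) 1)).
  apply: odd_sum => F /andP[fF _]; rewrite oddb crossing_odd // -sum1_card.
  by congr odd; apply: eq_bigl => B; rewrite !inE.
rewrite (exchange_big_dep (mem (bricks n K :&: S))) /=; last by move=> F B _ /andP[].
rewrite -sum_nat_const (bigID (fun B => R \subset B)) /= [X in _ + X]big1.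
  rewrite addn0; congr odd; apply: eq_big => [B|B /andP[bB sRB]].
    by rewrite [RHS]in_set.
  have {bB} [bB SB] : B \in bricks n K /\ B \in S.
    by apply/andP; rewrite -in_setI.
  rewrite -(card_between sRB) ?card_brick // -sum1_card.
  apply: eq_bigl => F; rewrite in_set in_setI bB SB /=.
  case sFB: (F \subset B); rewrite ?andbF ?andbT //= andbC; congr (_ && _).
  apply/idP/eqP => [|cF]; first by rewrite in_set => /andP[_ /eqP].
  exact: (proj1 thinK) bB sFB cF.
move=> B /andP[_ nsRB]; apply: big1 => F /andP[/andP[_ sRF]] /andP[_ sFB].
by rewrite (subset_trans sRF sFB) in nsRB.
Qed.

Lemma odd_cut S : odd n.+1 -> odd (cut S) = odd #|bricks n K :&: S|.
Proof.
move=> on; have := odd_crossing_over S set0.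
rewrite cards0 subn0 oddM on andbT => H.
transitivity (odd #|[set F in crossing S | set0 \subset F]|).
  by congr odd; apply: eq_card => F; rewrite [RHS]inE sub0set andbT.
by rewrite H; congr odd; apply: eq_card => F; rewrite [LHS]inE sub0set andbT.
Qed.

(** Let [F] be a crossing facet.  As crossing facets form a cycle, for each vertex
    [x] of [F] another crossing facet contains [F] without [x].  These [n] facets
    differ from [F], and pairwise, since each misses its own vertex of [F]. *)
Lemma cut_ge S : 0 < n -> 0 < cut S -> n < cut S.
Proof.
move=> n0 /card_gt0P[F crF].
have fF : F \in facets n K by move: crF; rewrite inE => /andP[].
have cF : #|F| = n by move: fF; rewrite inE => /andP[_ /eqP].
pose star x := [set G in crossing S | F :\ x \subset G].
have [f fP] : exists f : T -> {set T}, forall x, x \in F ->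
    [/\ f x \in crossing S, f x != F & F :\ x \subset f x].
  have ex x : exists G, (x \in F) ==> [&& G \in crossing S, G != F & F :\ x \subset G].
    case: (boolP (x \in F)) => [xF|]; last by exists F.
    have cR : #|F :\ x| = n.-1 by rewrite -cF (cardsD1 x F) xF.
    have Fst : F \in star x by rewrite inE crF subD1set.
    have : 0 < #|star x :\ F|.
      have := odd_crossing_over S (F :\ x); rewrite -/(star x) (cardsD1 F) Fst.
      rewrite cR oddM; have -> : n.+1 - n.-1 = 2 by lia.
      by rewrite andbF; case: #|_|.
    case/card_gt0P=> G; rewrite !inE => /andP[GF /andP[cG sG]].
    by exists G; rewrite !inE cG GF sG.
  exists (fun x => xchoose (ex x)) => x xF.
  by have /implyP/(_ xF)/and3P[] := xchooseP (ex x).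
have cf x : x \in F -> x \notin f x.
  move=> xF; have [fcr fne sf] := fP x xF.
  apply: contra fne => xf; rewrite eq_sym eqEcard cF.
  move: fcr; rewrite inE => /andP[]; rewrite inE => /andP[_ /eqP->] _.
  rewrite leqnn andbT; apply/subsetP=> y yF.
  case: (eqVneq y x) => [->//|nyx]; apply: (subsetP sf).
  by rewrite !inE nyx.
have injf : {in F &, injective f}.
  move=> x y xF yF eqf; apply/eqP; apply: contraT => nxy.
  have [_ _ sf] := fP y yF; have := cf x xF; rewrite eqf.
  by rewrite (subsetP sf) // !inE nxy.
rewrite -cF -(card_in_imset injf) /cut (cardsD1 F (crossing S)) crF ltnS.
apply: subset_leq_card; apply/subsetP=> _ /imsetP[x xF ->].
by have [? ? _] := fP x xF; rewrite in_setD1; apply/andP.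
Qed.

End Cut.

(** This is [(n + 1)]-edge-connectivity of the dual graph. *)
Definition tight (T : finType) n (K : {set {set T}}) : Prop :=
  forall (S : {set {set T}}) B B', B \in bricks n K -> B \in S ->
    B' \in bricks n K -> B' \notin S -> n < cut n K S.

Lemma pseudomanifold_thin (T : finType) n (K : {set {set T}}) :
  pseudomanifold n K -> thin n K.
Proof.
case=> -[_ dc] _ two _; split=> // B F; rewrite in_set => /andP[KB _] sFB cF.
by rewrite in_set cF eqxx andbT; apply: dc sFB.
Qed.

Lemma pseudomanifold_tight (T : finType) n (K : {set {set T}}) :
  0 < n -> pseudomanifold n K -> tight n K.
Proof.
move=> n0 pm S B B' bB SB bB' SB'.
apply: (cut_ge (pseudomanifold_thin pm) n0); rewrite lt0n.
apply/eqP => /eqP; rewrite cards_eq0 => /eqP cr0.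
have [_ _ _ /(_ B B' bB bB') conn] := pm.
have cl : fingraph.closed (adjacent n K) (mem S).
  move=> X Y /and4P[bX bY _ /exists_inP[F fF /andP[sFX sFY]]].
  have notcr : F \notin crossing n K S by rewrite cr0 inE.
  apply/idP/idP => [SX|SY]; apply: contraNT notcr => nS;
    rewrite in_set fF /=; apply/andP; split; apply/hitsP.
  - by exists X.
  - by exists Y; rewrite in_setC.
  - by exists Y.
  - by exists X; rewrite in_setC.
by have := closed_connect cl conn; rewrite /= SB (negPf SB').
Qed.

(** * Widths read off enumerations of the bricks *)

Section Profile.
Variables (T : finType) (n : nat) (K : {set {set T}}).

Definition enumerates (s : seq {set T}) : Prop := uniq s /\ s =i bricks n K.

Definition profile (s : seq {set T}) t := cut n K [set B in take t s].

Lemma mem_prefix s t B : enumerates s -> B \in bricks n K ->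
  (B \in [set X in take t s]) = (index B s < t).
Proof. by case=> _ sK bB; rewrite in_set in_take ?sK. Qed.

Lemma profile0 s : profile s 0 = 0.
Proof.
rewrite /profile take0 -[RHS](cut0 n K).
by apply: eq_cut => B _; rewrite !inE.
Qed.

Lemma profile_size s : enumerates s -> profile s (size s) = 0.
Proof.
case=> _ sK; rewrite /profile take_size -cutC -[RHS](cut0 n K).
by apply: eq_cut => B bB; rewrite !inE sK bB.
Qed.

Lemma profile_odd s t : thin n K -> odd n.+1 -> enumerates s -> t <= size s ->
  odd (profile s t) = odd t.
Proof.
move=> th on [us sK] le_t; rewrite odd_cut //; congr odd.
have -> : bricks n K :&: [set B in take t s] = [set B in take t s].
  apply/setIidPr/subsetP => B; rewrite inE => /mem_take; by rewrite sK.
by rewrite cardsE (card_uniqP _) ?take_uniq // size_takel.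
Qed.

Lemma profile_noplat s t : thin n K -> odd n.+1 -> enumerates s -> t < size s ->
  profile s t != profile s t.+1.
Proof.
move=> th on es lt_t; apply: contraTneq isT => eqp.
have := profile_odd th on es lt_t; rewrite -eqp profile_odd ?(ltnW lt_t) //=.
by case: odd.
Qed.

Definition profile_width (f : nat -> nat) N : seq nat :=
  sort geq [seq f t | t <- iota 1 N.-1 & peak f t].

Lemma weight_profile_width k f N : f 0 = 0 ->
    (forall t, t < N -> f t != f t.+1) ->
  \sum_(x <- profile_width f N) k ^ x = passed k f N.
Proof.
move=> f0 np; rewrite passed_peaks // (perm_big _ (permEl (perm_sort _ _))) /=.
by rewrite big_map big_filter /index_iota subn1.
Qed.

Lemma profile_width_sorted f N : sorted geq (profile_width f N).
Proof. by apply: sort_sorted => x y; exact: leq_total. Qed.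

Hypotheses (thK : thin n K) (on : odd n.+1).

(** As consecutive values of the profile differ, a maximal plateau is a point. *)
Lemma width_of_profile (O : preordering n K) s : enumerates s ->
    (forall B, O B = index (val B) s :> nat) ->
  width_of O = profile_width (profile s) (size s).
Proof.
move=> es Os; have [us sK] := es.
have sN : size s = nbricks n K.
  rewrite /nbricks card_sig -(card_uniqP us); exact: eq_card.
have LE t : Lambda O t = profile s t.
  rewrite /Lambda /profile /cut; apply: eq_card => F; rewrite !in_set.
  congr (_ && _); apply/existsP/andP.
    case=> B /existsP[B' /and4P[]]; rewrite /position !Os ltnS => lt ge sB sB'.
    split; apply/hitsP.
      by exists (val B); rewrite (mem_prefix _ es) ?(valP B).
    exists (val B').
    by rewrite in_setC (mem_prefix _ es) ?(valP B') // -leqNgt ge.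
  case=> /hitsP[B [bB]]; rewrite (mem_prefix _ es) // => lt sB.
  case/hitsP=> B' [bB']; rewrite in_setC (mem_prefix _ es) // -leqNgt => ge sB'.
  exists (exist _ B bB); apply/existsP; exists (exist _ B' bB').
  by rewrite /position !Os /= sB sB' !ltnS lt ge.
rewrite /width_of /profile_width -sN; congr sort.
rewrite (eq_map LE); congr map; apply: eq_in_filter => t.
rewrite mem_iota => /andP[t0 ltN]; rewrite /is_maximum /peak.
have np u : u < size s -> profile s u != profile s u.+1 by exact: profile_noplat.
apply/existsP/andP => [[tm /existsP[tp /and5P[lt_m lt_p up dn /forallP eqk]]]|].
  have eqkn k : tm < k -> k < tp -> profile s t = profile s k.
    move=> lt_mk lt_kp; have lt : k < (nbricks n K).+1 by have := ltn_ord tp; lia.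
    by have := eqk (Ordinal lt); rewrite /= lt_mk lt_kp !LE => /eqP.
  move: up dn; rewrite !LE => up dn.
  have le_tp : tp <= size s by rewrite sN -ltnS ltn_ord.
  have em : t.-1 = tm.
    apply/eqP; apply: contraT => ne.
    have /negP[] : profile s tm.+1 != profile s tm.+2 by apply: np; lia.
    by rewrite -!eqkn ?eqxx //; lia.
  have ep : tp = t.+1 :> nat.
    apply/eqP; apply: contraT => ne.
    have /negP[] : profile s t != profile s t.+1 by apply: np; lia.
    by rewrite -(eqkn t.+1) ?eqxx //; lia.
  by move: up dn; rewrite ep -em prednK // => up dn; split.
case=> up dn.
have lm : t.-1 < (nbricks n K).+1 by rewrite -sN; lia.
have lp : t.+1 < (nbricks n K).+1 by rewrite -sN; lia.
exists (Ordinal lm); apply/existsP; exists (Ordinal lp).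
rewrite /= !LE prednK // up dn leqnn ltnS leqnn /=.
apply/forallP=> k; apply/implyP => /andP[]; rewrite !LE => ? ?.
by apply/eqP; congr profile; lia.
Qed.

Lemma width_le_profile s : enumerates s ->
  (width n K <= (profile_width (profile s) (size s) : seqlexi nat))%O.
Proof.
move=> es; have [us sK] := es.
have lt (B : brick n K) : index (val B) s < nbricks n K.
  rewrite /nbricks card_sig -(eq_card sK) (card_uniqP us) index_mem sK.
  exact: valP.
pose O : preordering n K := [ffun B => Ordinal (lt B)].
have OE B : O B = index (val B) s :> nat by rewrite ffunE.
rewrite -(width_of_profile es OE); apply: width_min.
apply/injectiveP => B B' /(congr1 val) /=; rewrite !OE => eqi; apply: val_inj.
have mem_s (X : brick n K) : val X \in s by rewrite sK; exact: valP.
by rewrite -(nth_index (val B) (mem_s B)) eqi nth_index.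
Qed.

Lemma width_eq_profile : exists2 s, enumerates s &
  width n K = profile_width (profile s) (size s).
Proof.
have [O Oinj ->] := width_attained n K; move/injectiveP in Oinj.
have [inv invK Kinv] : bijective O by apply: inj_card_bij; rewrite ?card_ord.
pose s := [seq val (inv i) | i <- enum 'I_(nbricks n K)].
have injv : injective (fun i => val (inv i)).
  by move=> i j /val_inj /(can_inj Kinv).
have es : enumerates s.
  split; first by rewrite map_inj_uniq ?enum_uniq.
  move=> B; apply/mapP/idP => [[i _ ->]|bB]; first exact: valP.
  exists (O (exist _ B bB)); first by rewrite mem_enum.
  by rewrite invK.
exists s => //; apply: width_of_profile => // B.
by rewrite -[LHS]index_enum_ord -(index_map injv) /= invK.
Qed.

End Profile.

Lemma enumerates_size (T : finType) n (K : {set {set T}}) s :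
  enumerates n K s -> size s = #|bricks n K|.
Proof. by case=> us sK; rewrite -(card_uniqP us); apply: eq_card. Qed.

(** * Gluing two complexes along a brick *)

Section Amalgam.
Variables (T : finType) (n : nat).
Implicit Types (K : {set {set T}}) (F B C : {set T}) (S : {set {set T}}).

(** A brick is the union of two of its facets, so no other brick contains both. *)
Lemma two_other_bricks K C : 0 < n -> thin n K -> C \in bricks n K ->
  exists B B', [/\ B \in bricks n K :\ C, B' \in bricks n K :\ C & B != B'].
Proof.
move=> n0 [face two] bC; have cC := card_brick bC.
have other x : x \in C -> exists2 B, B \in bricks n K :\ C & C :\ x \subset B.
  move=> xC; have fF : C :\ x \in facets n K.
    apply: face bC (subD1set _ _) _; by move: cC; rewrite (cardsD1 x) xC => -[].
  have : 0 < #|[set B in bricks n K | C :\ x \subset B] :\ C|.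
    by move: (two _ fF); rewrite (cardsD1 C) in_set bC subD1set add1n => -[->].
  case/card_gt0P=> B; rewrite in_setD1 in_set => /and3P[nBC bB sB].
  by exists B; rewrite // in_setD1 nBC.
have [x [y [xC yC nxy]]] : exists x y, [/\ x \in C, y \in C & x != y].
  by apply/card_gt1P; rewrite cC ltnS.
have [B bB sB] := other x xC; have [B' bB' sB'] := other y yC.
exists B, B'; split=> //; apply: contraL bB => /eqP eqB.
rewrite in_setD1 negb_and negbK eq_sym; apply/orP; left.
case: (boolP (B \in bricks n K)) => [bB|nb]; last first.
  by move: nb; rewrite eqB; move: bB'; rewrite in_setD1 => /andP[_ ->].
rewrite eqEcard (card_brick bB) cC leqnn andbT.
apply/subsetP=> z zC; case: (eqVneq z x) => [->|nzx].
  by rewrite eqB (subsetP sB') // !inE nxy.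
by rewrite (subsetP sB) // !inE nzx.
Qed.

Lemma cut_brick K C : 0 < n -> thin n K -> tight n K -> C \in bricks n K ->
  cut n K [set C] = n.+1.
Proof.
move=> n0 th tg bC; apply/eqP; rewrite eqn_leq; apply/andP; split.
  rewrite -[n.+1]subn0 -(cards0 T) -(card_between (sub0set C) (card_brick bC)).
  apply: subset_leq_card; apply/subsetP=> F; rewrite !in_set sub0set /=.
  case/and3P=> /andP[_ ->] /hitsP[B [_]]; rewrite in_set1 => /eqP->.
  by rewrite andbT.
have [B [_ [bB _ _]]] := two_other_bricks n0 th bC.
move: bB; rewrite in_setD1 => /andP[nBC bB].
by apply: tg bC (set11 _) bB _; rewrite in_set1.
Qed.

(** The union of two complexes whose common simplices lie in the common brick
    [C], the setting in which the connected sum is their union without [C]. *)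
Definition glued_along K1 K2 C : Prop :=
  [/\ C \in bricks n K1, C \in bricks n K2 &
      forall s : {set T}, s \in K1 -> s \in K2 -> s \subset C].

Definition sum_along K1 K2 C := (K1 :|: K2) :\ C.

Lemma glued_alongC K1 K2 C : glued_along K1 K2 C -> glued_along K2 K1 C.
Proof. by case=> ? ? sub; split=> // s K2s K1s; exact: sub. Qed.

Lemma sum_alongC K1 K2 C : sum_along K1 K2 C = sum_along K2 K1 C.
Proof. by rewrite /sum_along setUC. Qed.

Section Sum.
Variables (K1 K2 : {set {set T}}) (C : {set T}).
Hypotheses (n0 : 0 < n) (th1 : thin n K1) (th2 : thin n K2).
Hypothesis glued : glued_along K1 K2 C.
Let W := sum_along K1 K2 C.

Lemma bricks_sum B :
  (B \in bricks n W) = (B != C) && ((B \in bricks n K1) || (B \in bricks n K2)).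
Proof. by rewrite /W /sum_along !inE -andbA andb_orl. Qed.

Lemma facets_sum F :
  (F \in facets n W) = (F \in facets n K1) || (F \in facets n K2).
Proof.
rewrite /W /sum_along !inE -andb_orl; case: eqP => cF; rewrite ?andbF ?andbT //.
case: (F =P C) => //= eFC; case: glued => bC _ _.
by move: (card_brick bC); rewrite -eFC cF; lia.
Qed.

Lemma brick_common B : B \in bricks n K1 -> B \in bricks n K2 -> B = C.
Proof.
case: glued => bC _ sub bB1 bB2; apply/eqP.
rewrite eqEcard (card_brick bB1) (card_brick bC) leqnn andbT.
by move: bB1 bB2; rewrite !in_set => /andP[? _] /andP[? _]; apply: sub.
Qed.

Lemma facet_common F : F \in facets n K1 ->
  (F \in facets n K2) = (F \subset C).
Proof.
case: glued => bC1 bC2 sub fF; apply/idP/idP => [fF2|sFC].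
  by move: fF fF2; rewrite !in_set => /andP[? _] /andP[? _]; apply: sub.
by apply: (proj1 th2) bC2 sFC _; move: fF; rewrite in_set => /andP[_ /eqP].
Qed.

Lemma other_brick F : F \in facets n K2 -> F \subset C ->
  #|[set B in bricks n K2 | F \subset B] :\ C| = 1.
Proof.
case: glued => _ bC2 _ fF sFC; move: (proj2 th2 F fF).
by rewrite (cardsD1 C) in_set bC2 sFC => -[].
Qed.

(** A facet of [C] lies, besides [C], in one brick of each summand; as long as [C]
    and the second summand stay outside [S], it crosses in the sum exactly when it
    crosses in the first summand. *)
Lemma cut_sum S : C \notin S -> S \subset bricks n K1 -> cut n W S = cut n K1 S.
Proof.
case: glued => bC1 bC2 sub nCS sS1; apply: eq_card => F.
have face1 B : B \in S -> F \subset B -> #|F| = n -> F \in facets n K1.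
  by move=> SB; apply: (proj1 th1); exact: (subsetP sS1).
rewrite in_set [RHS]in_set facets_sum; apply/and3P/and3P.
  case=> fF /hitsP[B [bB SB sFB]] /hitsP[B' [bB' nSB' sFB']].
  have fF1 : F \in facets n K1.
    apply: face1 SB sFB _.
    by case/orP: fF; rewrite in_set => /andP[_ /eqP].
  split=> //; apply/hitsP; first by exists B; split=> //; exact: (subsetP sS1).
  move: bB'; rewrite bricks_sum => /andP[_ /orP[bB'|bB']]; first by exists B'.
  exists C; rewrite in_setC; split=> //; rewrite -facet_common //.
  by apply: (proj1 th2) bB' sFB' _; move: fF1; rewrite in_set => /andP[_ /eqP].
case=> fF /hitsP[B [bB SB sFB]] /hitsP[B' [bB' nSB' sFB']].
split; first by rewrite fF.
  apply/hitsP; exists B; split=> //; rewrite bricks_sum bB andbT.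
  by apply: contraNneq nCS => <-.
case: (eqVneq B' C) => [eB'|nB']; last first.
  by apply/hitsP; exists B'; rewrite bricks_sum nB' bB'.
rewrite eB' in sFB'; have fF2 : F \in facets n K2 by rewrite facet_common.
have /eqP/cards1P[D /setP/(_ D)] := other_brick fF2 sFB'.
rewrite set11 in_setD1 in_set => /and3P[nDC bD sFD].
apply/hitsP; exists D; rewrite bricks_sum nDC bD orbT in_setC; split=> //.
by apply: contra nDC => /(subsetP sS1) bD1; apply/eqP; exact: brick_common.
Qed.

(** The complement of the set on the left consists of bricks of the first summand,
    so [cut_sum] computes its cut. *)
Lemma cut_sum_cofull (S : {set {set T}}) : C \notin S ->
  cut n W (S :|: (bricks n K2 :\ C)) = cut n K1 (C |: S).
Proof.
move=> nCS; rewrite -cutC -[RHS]cutC.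
rewrite -[RHS](_ : cut n K1 (bricks n K1 :\: (C |: S)) = _); last first.
  by apply: eq_cut => B bB; rewrite in_setD bB andbT in_setC.
rewrite -cut_sum ?subsetDl //; last first.
  by rewrite in_setD in_setU1 eqxx.
apply: eq_cut => B; rewrite bricks_sum => /andP[nBC bB].
rewrite in_setC in_setU in_setD1 in_setD in_setU1 (negPf nBC) /= negb_or.
congr (_ && _); apply/idP/idP => [nb|b1].
  by case/orP: bB nb => [//|->].
by apply: contra nBC => b2; apply/eqP; exact: brick_common.
Qed.

End Sum.

Lemma thin_sum K1 K2 C : 0 < n -> thin n K1 -> thin n K2 -> glued_along K1 K2 C ->
  thin n (sum_along K1 K2 C).
Proof.
move=> n0 th1 th2 gl; split=> [B F|F].
  rewrite bricks_sum // => /andP[_ /orP[bB|bB]] sFB cF; rewrite (facets_sum n0 gl).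
    by rewrite (proj1 th1 B).
  by rewrite (proj1 th2 B) ?orbT.
rewrite (facets_sum n0 gl) => fF.
have cF : #|F| = n by case/orP: fF; rewrite in_set => /andP[_ /eqP].
pose over K := [set B in bricks n K | F \subset B].
have overE K B : (B \in over K) = (B \in bricks n K) && (F \subset B).
  by rewrite in_set.
have -> : [set B in bricks n (sum_along K1 K2 C) | F \subset B]
    = (over K1 :\ C) :|: (over K2 :\ C).
  apply/setP=> B; rewrite in_setU !in_setD1 !overE bricks_sum.
  by case: (_ != C); case: (F \subset B); rewrite ?andbT ?andbF.
rewrite cardsU (_ : _ :&: _ = set0) ?cards0 ?subn0; last first.
  apply/setP=> B; rewrite in_setI !in_setD1 !overE in_set0; apply/negP.
  case/andP=> /and3P[nBC b1 _] /and3P[_ b2 _].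
  by case/eqP: nBC; exact: (brick_common gl b1 b2).
have single K K' : thin n K -> thin n K' -> glued_along K K' C ->
    F \in facets n K -> F \notin facets n K' ->
    #|over K :\ C| = 2 /\ #|over K' :\ C| = 0.
  move=> th th' gl' fK nfK'; split.
    rewrite -(proj2 th F fK); apply: eq_card => B.
    rewrite in_setD1; case: eqP => // ->; rewrite overE.
    by rewrite -(facet_common th' gl' fK) (negPf nfK') andbF.
  apply/eqP; rewrite cards_eq0; apply/eqP/setP=> B; rewrite in_setD1 overE in_set0.
  apply/negP => /and3P[_ bB sFB]; case/negP: nfK'; exact: (proj1 th' B).
case f1: (F \in facets n K1); case f2: (F \in facets n K2).
- have sFC : F \subset C by rewrite -(facet_common th2 gl f1).
  rewrite (other_brick th2 gl) // (other_brick th1 (glued_alongC gl)) //.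
- by have [-> ->] := single _ _ th1 th2 gl f1 (negbT f2).
- by have [-> ->] := single _ _ th2 th1 (glued_alongC gl) f2 (negbT f1).
- by rewrite f1 f2 in fF.
Qed.

End Amalgam.

(** * The two bounds for complexes on a common vertex type *)

Lemma take_count_filter (A : eqType) (a : pred A) (s r : seq A) t :
  take (count a (take t s)) (filter a s ++ r) = filter a (take t s).
Proof.
rewrite -[in filter a s](cat_take_drop t s) filter_cat -catA -size_filter.
by rewrite take_size_cat.
Qed.

Section Bounds.
Variables (T : finType) (n : nat) (K1 K2 : {set {set T}}) (C : {set T}).
Hypotheses (n0 : 0 < n) (on : odd n.+1) (th1 : thin n K1) (th2 : thin n K2).
Hypotheses (tg1 : tight n K1) (tg2 : tight n K2) (glued : glued_along n K1 K2 C).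
Let W := sum_along K1 K2 C.
Let thW : thin n W := thin_sum n0 th1 th2 glued.

Lemma cut_sum2 (S : {set {set T}}) :
  C \notin S -> S \subset bricks n K2 -> cut n W S = cut n K2 S.
Proof.
rewrite /W sum_alongC; exact: (cut_sum n0 th2 th1 (glued_alongC glued)).
Qed.

Lemma cut_sum_cofull2 (S : {set {set T}}) : C \notin S ->
  cut n W (S :|: (bricks n K1 :\ C)) = cut n K2 (C |: S).
Proof.
rewrite /W sum_alongC.
exact: (cut_sum_cofull n0 th2 th1 (glued_alongC glued)).
Qed.

(** Write [P t] for the first [t] bricks of [s] and [A2] for the bricks coming from
    the second summand.  For [P t] and [A2], submodularity gives [hi t <= b t] and
    posimodularity gives [lo t <= b t], because [A2] has cut [n + 1], and the sets
    [P t :&: A2] and [A2 :\: P t] have at least that cut unless they are empty. *)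
Lemma restrict_ordering k s : 1 < k -> enumerates n W s ->
  exists2 s1, enumerates n K1 s1 &
    passed k (profile n K1 s1) (size s1) <= passed k (profile n W s) (size s).
Proof.
move=> k1 es; have [us sW] := es.
have [bC1 bC2 _] := glued.
pose A2 := bricks n K2 :\ C; pose b1 := mem (bricks n K1).
pose P t := [set B in take t s].
pose lo t := cut n W (P t :&: bricks n K1).
pose hi t := cut n W (P t :|: A2).
have memP t B : B \in bricks n W -> (B \in P t) = (index B s < t).
  exact: mem_prefix.
have bW B : (B \in bricks n W) =
    (B != C) && ((B \in bricks n K1) || (B \in bricks n K2)).
  exact: bricks_sum.
have sA2 B : B \in A2 -> B \in bricks n W.
  by rewrite in_setD1 bW => /andP[-> ->]; rewrite orbT.
have A2_1 B : B \in A2 -> B \notin bricks n K1.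
  rewrite in_setD1 => /andP[nBC b2]; apply: contra nBC => bB1.
  by apply/eqP; exact: (brick_common glued).
have W_1 B : B \in bricks n W -> (B \in A2) = (B \notin bricks n K1).
  move=> bB; apply/idP/idP => [/A2_1//|nb1]; move: bB.
  by rewrite bW (negPf nb1) in_setD1.
have CP t : C \notin P t.
  by apply: contraL bC1; rewrite in_set => /mem_take; rewrite sW bW eqxx.
have Pstep t : t < size s -> [/\ nth C s t \in bricks n W, nth C s t \notin P t &
    take t.+1 s = rcons (take t s) (nth C s t) /\ P t.+1 = nth C s t |: P t].
  move=> lt; have bv : nth C s t \in bricks n W by rewrite -sW mem_nth.
  split=> //; first by rewrite memP // index_uniq // ltnn.
  split; first exact: take_nth.
  apply/setP=> B; rewrite in_setU1 !in_set (take_nth C lt) mem_rcons inE.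
  reflexivity.
have step_A2 t : t < size s -> nth C s t \in A2 -> lo t.+1 = lo t /\ hi t.+1 = hi t.
  move=> lt Av; have [_ _ [_ Pv]] := Pstep t lt; rewrite /lo /hi Pv.
  split; apply: eq_cut => B _; rewrite ?in_setI !in_setU in_set1.
    by case: (B =P _) => // ->; rewrite (negPf (A2_1 _ Av)) !andbF.
  by case: (B =P _) => // ->; rewrite Av !orbT.
have [B0 [B0' [AB0 AB0' nB0]]] := two_other_bricks n0 th2 bC2.
case: (@arg_minnP _ B0 (mem A2) (index^~ s) AB0) => Bi ABi mini.
case: (@arg_maxnP _ B0 (mem A2) (index^~ s) AB0) => Bl ABl maxl.
have {}ABi : Bi \in A2 := ABi; have {}ABl : Bl \in A2 := ABl.
have Wi := sA2 _ ABi; have Wl := sA2 _ ABl.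
have idxs B : B \in bricks n W -> index B s < size s by rewrite index_mem sW.
have lt_il : index Bi s < index Bl s.
  have : index B0 s != index B0' s.
    apply: contra nB0 => /eqP eqi; apply/eqP.
    have B0s : B0 \in s by rewrite sW sA2.
    by rewrite -(nth_index C B0s) eqi nth_index // sW sA2.
  have := mini _ AB0; have := mini _ AB0'; have := maxl _ AB0; have := maxl _ AB0'.
  move: (index B0 s) (index B0' s) => /=; clear; lia.
have cutA2 : cut n W A2 = n.+1.
  rewrite -(set0U A2) (cut_sum_cofull n0 th1 th2 glued) ?in_set0 // setU0.
  exact: cut_brick.
have cut_part (S : {set {set T}}) B : S \subset A2 -> B \in S -> n < cut n W S.
  move=> sSA SB; have nCS : C \notin S.
    by apply/negP => /(subsetP sSA); rewrite in_setD1 eqxx.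
  have sS2 : S \subset bricks n K2 := subset_trans sSA (subsetDl _ _).
  rewrite cut_sum2 //; apply: (tg2 _ SB bC2 nCS); exact: (subsetP sS2).
have [] := @insertion_time k (size s) (profile n W s) lo hi
  (index Bi s).+1 (index Bl s).+1 => //.
- exact: idxs.
- exact: profile0.
- exact: profile_size.
- by move=> t lt; exact: profile_noplat.
- move=> t lt_t; apply: eq_cut => B bB; rewrite in_setI -/(P t) memP //.
  case: (ltnP (index B s) t) => // lt_Bt /=; rewrite -[LHS]negbK -W_1 //.
  apply/negP => /mini /= le; rewrite ltnS in lt_t.
  by have := leq_trans lt_Bt lt_t; rewrite ltnNge le.
- move=> t le_t _; apply: eq_cut => B bB; rewrite in_setU -/(P t) memP //.
  case: (boolP (B \in A2)) => [/maxl /= le|_]; last by rewrite orbF.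
  by rewrite orbT; apply/esym; apply: leq_trans le_t; rewrite ltnS.
- move=> t lt_t; rewrite -(leq_add2r n.+1).
  apply: (@leq_trans (cut n W (P t :\: A2) + cut n W (A2 :\: P t))).
    apply: leq_add; last first.
      apply: (@cut_part _ Bl); first exact: subsetDl.
      by rewrite in_setD ABl andbT memP // -leqNgt -ltnS.
    rewrite leq_eqVlt; apply/orP; left; apply/eqP; apply: eq_cut => B bB.
    by rewrite in_setI in_setD W_1 // negbK andbC.
  by rewrite -cutA2; exact: cut_posimodular.
- move=> t le_t _; rewrite -(leq_add2r n.+1).
  apply: (@leq_trans (cut n W (P t :|: A2) + cut n W (P t :&: A2))).
    rewrite leq_add2l; apply: (@cut_part _ Bi); first exact: subsetIr.
    by rewrite in_setI ABi andbT memP.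
  by rewrite -cutA2; exact: cut_submodular.
- move=> t lt_t; have [bv nPv [_ Pv]] := Pstep t lt_t.
  case: (boolP (nth C s t \in A2)) => [Av|nAv].
    by right; exact: step_A2 lt_t Av.
  left; set v := nth C s t in bv nPv Pv nAv.
  rewrite /lo /hi /profile -/(P t) -/(P t.+1) Pv.
  have b1v : v \in bricks n K1 by move: nAv; rewrite W_1 ?negbK.
  split.
    rewrite addnC.
    have e1 : (v |: P t) :&: bricks n K1 :|: P t = v |: P t.
      apply/setP=> B; rewrite !(in_setU, in_setI, in_set1).
      by case: (B =P v) => [->|_]; [rewrite b1v|case: (B \in P t); rewrite ?orbT ?andbF].
    have e2 : (v |: P t) :&: bricks n K1 :&: P t = P t :&: bricks n K1.
      apply/setP=> B; rewrite !(in_setU, in_setI, in_set1).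
      by case: (B =P v) => [->|_]; [rewrite (negPf nPv) !andbF|rewrite andbAC andbb].
    by have := cut_submodular n W ((v |: P t) :&: bricks n K1) (P t); rewrite e1 e2.
  rewrite addnC [leqRHS]addnC.
  have e1 : (v |: P t) :|: (P t :|: A2) = v |: P t :|: A2.
    by rewrite setUA -[v |: P t :|: P t]setUA setUid.
  have e2 : (v |: P t) :&: (P t :|: A2) = P t.
    apply/setP=> B; rewrite in_setI !in_setU in_set1.
    case: (B =P v) => [->|_]; first by rewrite (negPf nPv) (negPf nAv).
    by case: (B \in P t).
  by have := cut_submodular n W (v |: P t) (P t :|: A2); rewrite e1 e2.
- by apply: (step_A2 _ (idxs _ Wi) _).2; rewrite nth_index ?sW.
- by apply: (step_A2 _ (idxs _ Wl) _).1; rewrite nth_index ?sW.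
move=> m le_m ins; exists (filter b1 (take m s) ++ C :: filter b1 (drop m s)).
  split.
    rewrite -cat1s uniq_catCA cat1s -filter_cat cat_take_drop /= filter_uniq //.
    by rewrite mem_filter sW bW eqxx andbF.
  move=> B; rewrite mem_cat inE orbCA -mem_cat -filter_cat cat_take_drop.
  rewrite mem_filter sW bW /=; case: (B =P C) => [->|_] //=.
  by case: (B \in bricks n K1).
set s1 := _ ++ _.
pose c t := count b1 (take t s).
have cS t : t < size s -> c t.+1 = c t \/ c t.+1 = (c t).+1.
  move=> lt; have [_ _ [tv _]] := Pstep t lt; rewrite /c tv -cats1 count_cat /=.
  by case: (nth C s t \in _); rewrite /= ?addn0 ?addn1; [right|left].
(* The number of bricks of s1 met at time t of the sequence with the insertion *)
pose psi t := if t <= m then c t else (c t.-1).+1.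
have psi_steps : unit_steps psi (size s).+1.
  split; first by rewrite /psi /c take0.
  move=> t lt; rewrite /psi; case: (ltngtP t m) => [lt_tm|lt_mt|->] /=.
  - by apply: cS; apply: leq_trans lt_tm le_m.
  - case: t lt lt_mt => // t lt lt_mt /=.
    by case: (cS t lt) => ->; [left|right].
  - by right.
have size_s1 : size s1 = psi (size s).+1.
  rewrite /psi [_ <= m]leqNgt ltnS le_m /=.
  by rewrite size_cat /= !size_filter addnS -count_cat cat_take_drop /c take_size.
have eq_ins t : t <= (size s).+1 ->
    inserted lo hi m t = (profile n K1 s1 \o psi) t.
  move=> le_t; rewrite /inserted /= /psi; case: leqP => [le_tm|lt_mt].
    rewrite /lo (cut_sum n0 th1 th2 glued) ?subsetIr //; last first.
      by rewrite in_setI (negPf (CP t)).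
    apply: eq_cut => B bB; rewrite in_setI bB andbT !in_set /s1.
    rewrite -[take t s](take_takel _ le_tm) /c -[take t s](take_takel _ le_tm).
    by rewrite take_count_filter mem_filter /= bB.
  case: t le_t lt_mt => // u le_u lt_mu /=.
  rewrite /hi (cut_sum_cofull n0 th1 th2 glued) //; apply: eq_cut => B bB.
  rewrite in_setU1 !in_set -(subnKC (lt_mu : m <= u)) /c takeD count_cat -addnS.
  rewrite /s1 -size_filter takeD take_size_cat // drop_size_cat //=.
  rewrite -[filter b1 (drop m s)]cats0 take_count_filter !mem_cat inE.
  by rewrite !mem_filter /= bB orbCA.
have [e1 _] := eq_passed k eq_ins.
by have [e2 _] := passed_reparam k (profile n K1 s1) psi_steps; rewrite size_s1 -e2 -e1.
Qed.

Lemma profile_gt (K : {set {set T}}) s t : tight n K -> enumerates n K s ->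
  0 < t -> t < size s -> n < profile n K s t.
Proof.
move=> tg es t0 lt; have [us sK] := es.
have memN u : u < size s -> nth C s u \in bricks n K by move=> lt_u; rewrite -sK mem_nth.
have s0 : 0 < size s by lia.
apply: (tg _ (nth C s 0) (nth C s t)); rewrite ?memN ?(mem_prefix _ es) ?memN //.
  by rewrite index_uniq.
by rewrite index_uniq // ltnn.
Qed.

Lemma profile_noplat_gt (K : {set {set T}}) s t t' : thin n K -> tight n K ->
    enumerates n K s -> t = t'.+1 \/ t' = t.+1 -> 0 < t -> t < size s ->
    t' <= size s -> profile n K s t' = n.+1 ->
  n.+1 < profile n K s t.
Proof.
move=> th tg es adj t0 lt le' eq'; have := profile_gt tg es t0 lt.
rewrite leq_eqVlt -eq' => /predU1P[eqp|//].
case: adj => adj.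
  have /negP[] : profile n K s t' != profile n K s t'.+1.
    by apply: profile_noplat => //; lia.
  by rewrite -adj eqp eqxx.
have /negP[] : profile n K s t != profile n K s t.+1 by exact: profile_noplat.
by rewrite -adj eqp eqxx.
Qed.

(** At the junction both profiles take the value [n + 1], the cut of one brick.
    Next to it they are at least that by edge-connectivity, and differ from it by
    parity. *)
Lemma concat_orderings k s1 s2 :
    enumerates n K1 (rcons s1 C) -> enumerates n K2 (C :: s2) ->
  enumerates n W (s1 ++ s2) /\
  passed k (profile n W (s1 ++ s2)) (size (s1 ++ s2)) =
    passed k (profile n K1 (rcons s1 C)) (size (rcons s1 C))
    + passed k (profile n K2 (C :: s2)) (size (C :: s2)).
Proof.
move=> es1 es2; have [us1 s1K] := es1; have [us2 s2K] := es2.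
have [bC1 bC2 _] := glued.
have size_gt K s : thin n K -> C \in bricks n K -> enumerates n K s -> 2 < size s.
  move=> th bC es; rewrite (enumerates_size es) (cardsD1 C) bC ltnS.
  have [B [B' [bB bB' nB]]] := two_other_bricks n0 th bC.
  by apply/card_gt1P; exists B, B'.
have := size_gt _ _ th1 bC1 es1; have := size_gt _ _ th2 bC2 es2.
rewrite size_rcons size_cat [size (C :: s2)]/=; set p := size s1; set q := size s2.
rewrite !ltnS => q1 p1.
have nC1 : C \notin s1 by move: us1; rewrite rcons_uniq => /andP[].
have nC2 : C \notin s2 by move: us2 => /= /andP[].
have mem1 B : B \in s1 = (B \in bricks n K1) && (B != C).
  rewrite -s1K mem_rcons inE; case: (B =P C) => [->|_]; last by rewrite andbT.
  by rewrite (negPf nC1).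
have mem2 B : B \in s2 = (B \in bricks n K2) && (B != C).
  rewrite -s2K inE; case: (B =P C) => [->|_]; last by rewrite andbT.
  by rewrite (negPf nC2).
split.
  split.
    rewrite cat_uniq; move: us1 us2; rewrite rcons_uniq /= => /andP[_ ->] /andP[_ ->].
    rewrite andbT /=; apply/hasPn => B; rewrite mem2 mem1 => /andP[b2 nBC].
    rewrite nBC andbT; apply: contra nBC => b1; apply/eqP.
    exact: (brick_common glued).
  by move=> B; rewrite mem_cat mem1 mem2 bricks_sum -andb_orl andbC.
set f := profile n W (s1 ++ s2); set f1 := profile n K1 _; set f2 := profile n K2 _.
have ff1 t : t <= p -> f t = f1 t.
  move=> le_t; rewrite /f /f1 /profile -cats1 !takel_cat //.
  rewrite (cut_sum n0 th1 th2 glued) //.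
    by apply/negP; rewrite in_set => /mem_take; apply/negP.
  by apply/subsetP=> B; rewrite in_set => /mem_take; rewrite mem1 => /andP[].
have ff2 j : f (p + j) = f2 j.+1.
  rewrite /f /f2 /profile takeD take_size_cat // drop_size_cat //=.
  have nCj : C \notin [set B in take j s2].
    by apply/negP; rewrite in_set => /mem_take; apply/negP.
  transitivity (cut n K2 (C |: [set B in take j s2])); last first.
    by apply: eq_cut => B _; rewrite in_setU1 !in_set inE.
  rewrite -cut_sum_cofull2 //; apply: eq_cut => B _.
  rewrite in_set mem_cat in_setU in_setD1 mem1 [_ && (B != C)]andbC orbC.
  by congr (_ || _); rewrite in_set.
have f2_1 : f2 1 = n.+1.
  rewrite /f2 /profile /= take0 -(cut_brick n0 th2 tg2 bC2).
  by apply: eq_cut => B _; rewrite !inE.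
have f1_p : f1 p = n.+1 by rewrite -ff1 // -[p]addn0 ff2.
have up2 : f2 1 < f2 2.
  rewrite f2_1; by apply: (profile_noplat_gt th2 tg2 es2 (or_introl _) _ _ _ f2_1).
have dn1 : f1 p < f1 p.-1.
  rewrite f1_p; apply: (profile_noplat_gt th1 tg1 es1 (or_intror _) _ _ _ f1_p);
    rewrite ?size_rcons -/p; lia.
by apply: passed_concat => //; [lia|lia|exact: profile0].
Qed.

Lemma weight_width (K : {set {set T}}) s k : thin n K -> enumerates n K s ->
  \sum_(x <- profile_width (profile n K s) (size s)) k ^ x
    = passed k (profile n K s) (size s).
Proof.
move=> th es; apply: weight_profile_width; first exact: profile0.
by move=> t; exact: profile_noplat.
Qed.

Lemma width_sum_ge : (width n K1 <= width n W)%O.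
Proof.
have [s es ->] := width_eq_profile thW on.
set w := profile_width _ _; pose k := (size w).+2.
have [s1 es1 le] := restrict_ordering (isT : 1 < k) es.
apply: le_trans (width_le_profile th1 on es1) _.
apply: (@lexi_of_weight k) => //; first exact: profile_width_sorted.
by rewrite !weight_width.
Qed.

Lemma width_sum_le s1 s2 :
    enumerates n K1 (rcons s1 C) -> enumerates n K2 (C :: s2) ->
    width n K1 = profile_width (profile n K1 (rcons s1 C)) (size (rcons s1 C)) ->
    width n K2 = profile_width (profile n K2 (C :: s2)) (size (C :: s2)) ->
  (width n W <= width_union (width n K1) (width n K2))%O.
Proof.
move=> es1 es2 w1 w2; pose k := (size (width_union (width n K1) (width n K2))).+2.
have [es eqp] := concat_orderings k es1 es2.
apply: le_trans (width_le_profile thW on es) _.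
apply: (@lexi_of_weight k) => //.
  by apply: sort_sorted => x y; exact: leq_total.
rewrite /width_union [leqRHS](perm_big _ (permEl (perm_sort _ _))) big_cat /= w1 w2.
by rewrite !weight_width // eqp.
Qed.

End Bounds.

(** * Embedding the vertex types *)

Section Image.
Variables (T T' : finType) (n : nat) (h : T -> T').
Hypothesis hinj : injective h.
Implicit Types (K : {set {set T}}) (s : seq {set T}).

Definition image_complex K : {set {set T'}} := [set h @: s | s : {set T} in K].

Lemma imset_injS (A B : {set T}) : (h @: A \subset h @: B) = (A \subset B).
Proof.
apply/idP/idP => [/subsetP sub|]; last exact: imsetS.
by apply/subsetP=> x xA; rewrite -(mem_imset B x hinj) sub ?imset_f.
Qed.

Lemma mem_image K (A : {set T}) : (h @: A \in image_complex K) = (A \in K).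
Proof. exact: mem_imset (imset_inj hinj). Qed.

Lemma mem_bricks_image K (A : {set T}) :
  (h @: A \in bricks n (image_complex K)) = (A \in bricks n K).
Proof. by rewrite !in_set mem_image card_imset. Qed.

Lemma mem_facets_image K (A : {set T}) :
  (h @: A \in facets n (image_complex K)) = (A \in facets n K).
Proof. by rewrite !in_set mem_image card_imset. Qed.

Lemma bricks_imageP K B : B \in bricks n (image_complex K) ->
  exists2 A, A \in bricks n K & B = h @: A.
Proof.
move=> bB; have := bB; rewrite in_set => /andP[/imsetP[A _ eB] _].
by exists A; rewrite // -mem_bricks_image -eB.
Qed.

Lemma facets_imageP K F : F \in facets n (image_complex K) ->
  exists2 A, A \in facets n K & F = h @: A.
Proof.
move=> bF; have := bF; rewrite in_set => /andP[/imsetP[A _ eF] _].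
by exists A; rewrite // -mem_facets_image -eF.
Qed.

Lemma cut_image K (S : {set {set T'}}) :
  cut n (image_complex K) S = cut n K [set A : {set T} | h @: A \in S].
Proof.
have hitsE S' (F : {set T}) : hits n (image_complex K) S' (h @: F)
    = hits n K [set A : {set T} | h @: A \in S'] F.
  apply/hitsP/hitsP => [[B [/bricks_imageP[A bA ->] SA sFA]]|[A [bA SA sFA]]].
    by exists A; split; rewrite ?bA -?imset_injS // inE.
  by exists (h @: A); rewrite mem_bricks_image imset_injS; move: SA; rewrite in_set.
rewrite -[RHS](card_imset _ (imset_inj hinj)); apply: eq_card => F.
have crE (A : {set T}) : (h @: A \in crossing n (image_complex K) S)
    = (A \in crossing n K [set A : {set T} | h @: A \in S]).
  rewrite [LHS]in_set [RHS]in_set mem_facets_image !hitsE; congr (_ && (_ && _)).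
  by congr hits; apply/setP=> B; rewrite !inE.
apply/idP/imsetP => [crF|[A crA ->]]; last by rewrite crE.
have [A fA eF] : exists2 A, A \in facets n K & F = h @: A.
  by apply: facets_imageP; move: crF; rewrite in_set => /andP[].
by exists A; rewrite // -crE -eF.
Qed.

Lemma thin_image K : thin n K -> thin n (image_complex K).
Proof.
case=> face two; split=> [_ F /bricks_imageP[B bB ->] sFB cF|F /facets_imageP[A fA ->]].
  have eF : F = h @: (h @^-1: F).
    apply/setP=> y; apply/idP/imsetP => [yF|[x]]; last by rewrite inE => ? ->.
    have /imsetP[x _ ey] := subsetP sFB y yF.
    by exists x; rewrite // inE -ey.
  rewrite eF mem_facets_image; apply: (face B) => //.
    by rewrite -imset_injS -eF.
  by rewrite -(card_imset _ hinj) -eF.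
rewrite -(two A fA) -[RHS](card_imset _ (imset_inj hinj)); apply: eq_card => B.
rewrite in_set; apply/andP/imsetP => [[bB sAB]|[D DA ->]].
  have [D bD eB] := bricks_imageP bB.
  by exists D; rewrite // in_set bD -imset_injS -eB.
by move: DA; rewrite in_set mem_bricks_image imset_injS => /andP.
Qed.

Lemma tight_image K : tight n K -> tight n (image_complex K).
Proof.
move=> tg S _ _ /bricks_imageP[A bA ->] SA /bricks_imageP[A' bA' ->] nSA'.
by rewrite cut_image; apply: (tg _ A A') => //; rewrite inE.
Qed.

Lemma enumerates_image K s : enumerates n K s ->
  enumerates n (image_complex K) [seq h @: A | A : {set T} <- s].
Proof.
case=> us sK; split; first by rewrite (map_inj_uniq (imset_inj hinj)).
move=> B; apply/mapP/idP => [[A As ->]|/bricks_imageP[A bA ->]].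
  by rewrite mem_bricks_image -sK.
by exists A; rewrite ?sK.
Qed.

Lemma enumerates_preimage K (s' : seq {set T'}) : enumerates n (image_complex K) s' ->
  exists2 s, enumerates n K s & s' = [seq h @: A | A : {set T} <- s].
Proof.
case=> us sK; have im B : B \in s' -> h @: (h @^-1: B) = B.
  rewrite sK => /bricks_imageP[A _ ->].
  suff -> : h @^-1: (h @: A) = A by [].
  by apply/setP=> x; rewrite inE mem_imset.
have es' : s' = [seq h @: A | A : {set T} <- [seq h @^-1: B | B : {set T'} <- s']].
  by rewrite -map_comp -[LHS]map_id; apply/eq_in_map => B /im /= ->.
exists [seq h @^-1: B | B : {set T'} <- s']; last exact: es'.
split; first by move: us; rewrite {1}es' => /map_uniq.
move=> A; rewrite -mem_bricks_image -sK {2}es' mem_map //; exact: imset_inj.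
Qed.

Lemma profile_image K s t :
  profile n (image_complex K) [seq h @: A | A : {set T} <- s] t = profile n K s t.
Proof.
rewrite /profile cut_image; apply: eq_cut => A _.
by rewrite !inE -map_take mem_map //; exact: imset_inj.
Qed.

Lemma profile_width_image K s :
  profile_width (profile n (image_complex K) [seq h @: A | A : {set T} <- s])
    (size [seq h @: A | A : {set T} <- s])
  = profile_width (profile n K s) (size s).
Proof.
rewrite size_map /profile_width; congr sort; rewrite (eq_map (profile_image K s)).
by congr map; apply: eq_filter => t; rewrite /peak !profile_image.
Qed.

Lemma width_image K : thin n K -> odd n.+1 ->
  width n (image_complex K) = width n K.
Proof.
move=> th on; have th' := thin_image th; apply: le_anti; apply/andP; split.
  have [s es ->] := width_eq_profile th on.
  rewrite -profile_width_image; apply: width_le_profile => //.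
  exact: enumerates_image.
have [s' es' ->] := width_eq_profile th' on.
have [s es ->] := enumerates_preimage es'.
by rewrite profile_width_image; exact: width_le_profile.
Qed.

End Image.

Section Glue.
Variables (T1 T2 : finType) (C1 : {set T1}) (C2 : {set T2}).

Lemma brick_bijection : #|C1| = #|C2| -> 0 < #|C2| ->
  exists2 g : T1 -> T2, {in C1 &, injective g} & g @: C1 = C2.
Proof.
move=> eqC /card_gt0P[y0 _].
pose g x := nth y0 (enum C2) (index x (enum C1)).
have idx x : x \in C1 -> index x (enum C1) < size (enum C2).
  by rewrite -cardE -eqC cardE index_mem mem_enum.
have ginj : {in C1 &, injective g}.
  move=> x y xC yC /eqP; rewrite nth_uniq ?idx ?enum_uniq // => /eqP eqi.
  have xe : x \in enum C1 by rewrite mem_enum.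
  by rewrite -(nth_index x xe) eqi nth_index // mem_enum.
exists g => //; apply/eqP; rewrite eqEcard card_in_imset // eqC leqnn andbT.
apply/subsetP=> _ /imsetP[x xC ->]; rewrite -mem_enum.
by rewrite mem_nth ?idx.
Qed.

Variable g : T1 -> T2.
Hypotheses (ginj : {in C1 &, injective g}) (gC : g @: C1 = C2).

Lemma boundary_iso : simplicial_iso (boundary C1) (boundary C2) g.
Proof.
have inC (s : {set T1}) : s \in boundary C1 -> s \subset C1.
  by rewrite inE => /proper_sub.
have sub : {subset cover (boundary C1) <= C1}.
  by apply/subsetP/bigcupsP => s; exact: inC.
split; first by move=> x y /sub xC /sub yC; exact: ginj.
apply/setP=> t; apply/imsetP/idP => [[s bs ->]|].
  have ginj_s : {in s &, injective g}.
    by move=> x y /(subsetP (inC _ bs)) xC /(subsetP (inC _ bs)) yC; exact: ginj.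
  rewrite inE properEcard -gC imsetS ?inC //= !card_in_imset //.
  by apply: proper_card; move: bs; rewrite inE.
rewrite inE => prt; exists (C1 :&: g @^-1: t).
  rewrite inE properE subsetIl subsetI subxx /=.
  apply/negP => sub1; move: prt; rewrite properE => /andP[_ /negP[]].
  rewrite -gC; apply/subsetP => _ /imsetP[x /(subsetP sub1) xt ->].
  by move: xt; rewrite inE.
apply/setP=> y; apply/idP/imsetP => [yt|[x]].
  have : y \in C2 by exact: (subsetP (proper_sub prt)).
  rewrite -gC => /imsetP[x xC ey]; exists x => //.
  by rewrite !inE xC -ey.
by rewrite !inE => /andP[_ ?] ->.
Qed.

Lemma glue_inj : injective (glue C1 g).
Proof.
move=> x y; rewrite /glue; case: ifP => xC; case: ifP => yC //.
  by case=> /ginj; apply.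
by case.
Qed.

Lemma glue_brick : glue C1 g @: C1 = inr @: C2.
Proof.
rewrite -gC -imset_comp; apply: eq_in_imset => x xC.
by rewrite /glue xC.
Qed.

Lemma connected_sumE (V1 : {set {set T1}}) (V2 : {set {set T2}}) :
  connected_sum V1 V2 C1 C2 g =
  sum_along (image_complex (glue C1 g) V1) (image_complex inr V2) (inr @: C2).
Proof.
have imD (T : finType) (h : T -> T1 + T2) (V : {set {set T}}) (D : {set T}) :
    injective h ->
    [set h @: s | s : {set T} in V :\ D] = image_complex h V :\ (h @: D).
  move=> hinj; apply/setP=> s; rewrite in_setD1; apply/imsetP/andP.
    case=> A; rewrite in_setD1 => /andP[nAD VA] ->; rewrite mem_image //.
    by rewrite (inj_eq (imset_inj hinj)).
  case=> nsD /imsetP[A VA es]; exists A => //; rewrite in_setD1 VA andbT.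
  by apply: contra nsD => /eqP <-; rewrite es.
rewrite /connected_sum /sum_along setDUl imD; last exact: glue_inj.
by rewrite imD ?glue_brick //; move=> x y [].
Qed.

Lemma glued_image n (V1 : {set {set T1}}) (V2 : {set {set T2}}) :
  C1 \in bricks n V1 -> C2 \in bricks n V2 ->
  glued_along n (image_complex (glue C1 g) V1) (image_complex inr V2) (inr @: C2).
Proof.
have inr_inj : injective (inr : T2 -> T1 + T2) by move=> x y [].
move=> bC1 bC2; split.
- by rewrite -glue_brick mem_bricks_image //; exact: glue_inj.
- by rewrite mem_bricks_image.
- move=> _ /imsetP[A _ ->] /imsetP[A' _ eA]; rewrite -glue_brick; apply: imsetS.
  apply/subsetP => x xA; have : glue C1 g x \in inr @: A' by rewrite -eA imset_f.
  by case/imsetP=> y _; rewrite /glue; case: ifP.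
Qed.

End Glue.

Theorem corollary5p2 (n : nat) (hn : 2 <= n) (hn_even : ~~ odd n)
    (T1 T2 : finType) (V1 : {set {set T1}}) (V2 : {set {set T2}})
    (hV1 : pseudomanifold n V1) (hV2 : pseudomanifold n V2) :
  exists (C1 : {set T1}) (C2 : {set T2}) (g : T1 -> T2),
    [/\ C1 \in bricks n V1, C2 \in bricks n V2,
        simplicial_iso (boundary C1) (boundary C2) g,
        (Order.max (width n V1) (width n V2)
           <= width n (connected_sum V1 V2 C1 C2 g))%O &
        (width n (connected_sum V1 V2 C1 C2 g)
           <= width_union (width n V1) (width n V2))%O].
Proof.
have n0 : 0 < n := ltnW hn.
have th1 := pseudomanifold_thin hV1; have th2 := pseudomanifold_thin hV2.
have tg1 := pseudomanifold_tight n0 hV1; have tg2 := pseudomanifold_tight n0 hV2.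
have ex_brick (T : finType) (V : {set {set T}}) : pseudomanifold n V ->
    exists B, B \in bricks n V.
  by case=> -[V0 _] pure _ _; have [B bB _] := pure _ V0; exists B.
have [s1 es1 w1] := width_eq_profile th1 hn_even.
have [s2 es2 w2] := width_eq_profile th2 hn_even.
have [B1] := ex_brick _ _ hV1; rewrite -(proj2 es1) => s1B.
have [B2] := ex_brick _ _ hV2; rewrite -(proj2 es2) => s2B.
case/lastP: s1 es1 w1 s1B => // s1 C1 es1 w1 _.
case: s2 es2 w2 s2B => // C2 s2 es2 w2 _.
have bC1 : C1 \in bricks n V1 by rewrite -(proj2 es1) mem_rcons mem_head.
have bC2 : C2 \in bricks n V2 by rewrite -(proj2 es2) mem_head.
have [||g ginj gC] := @brick_bijection _ _ C1 C2.
- by rewrite (card_brick bC1) (card_brick bC2).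
- by rewrite (card_brick bC2).
have hinj1 := glue_inj ginj.
have hinj2 : injective (inr : T2 -> T1 + T2) by move=> x y [].
have gl := glued_image ginj gC bC1 bC2.
have th1' := thin_image hinj1 th1; have th2' := thin_image hinj2 th2.
have tg1' := tight_image hinj1 tg1; have tg2' := tight_image hinj2 tg2.
exists C1, C2, g; split=> //; first exact: boundary_iso.
  rewrite connected_sumE // -(width_image hinj1 th1) // -(width_image hinj2 th2) //.
  rewrite ge_max width_sum_ge //= sum_alongC width_sum_ge //.
  exact: glued_alongC.
rewrite connected_sumE // -(width_image hinj1 th1) // -(width_image hinj2 th2) //.
have map1 : [seq glue C1 g @: A | A : {set T1} <- rcons s1 C1]
    = rcons [seq glue C1 g @: A | A : {set T1} <- s1] (inr @: C2).
  by rewrite map_rcons (glue_brick gC).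
have es1' := enumerates_image hinj1 es1; have es2' := enumerates_image hinj2 es2.
rewrite map1 in es1'.
apply: (width_sum_le n0 hn_even th1' th2' tg1' tg2' gl es1' es2').
  by rewrite -map1 profile_width_image // width_image.
by rewrite -[_ :: _]map_cons profile_width_image // width_image.
Qed.
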